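(* For each integer $n \ge 1$ let $P_n^* := P(\pi \preceq \sigma)$, where $\pi, \sigma \in S_n$ are selected independently and uniformly at random and $\preceq$ is the weak Bruhat order on $S_n$. Then $P_n^*$ is submultiplicative, i.e. $P_{n_1+n_2}^* \le P_{n_1}^* P_{n_2}^*$ for all $n_1, n_2 \ge 1$. Consequently there exists $\rho = \lim_{n\to\infty} \sqrt[n]{P_n^*}$. Furthermore, there exists an absolute constant $c > 0$ such that for all $n \ge 1$ $$\prod_{i=1}^n \frac{H(i)}{i} \le P_n^* \le c\,(0.362)^n,$$ where $H(i) := \sum_{j=1}^i 1/j$. Consequently, $\rho \le 0.362$.
   Context: $S_n$ is the set of permutations of $[n] = \{1,\dots,n\}$, written in one-line notation $\omega = \omega(1)\cdots\omega(n)$. A simple reduction of $\omega \in S_n$ is a permutation obtained from $\omega$ by transposing two adjacent elements $\omega(i), \omega(i+1)$ with $\omega(i) > \omega(i+1)$. In the weak Bruhat order, $\pi \preceq \sigma$ if there is a chain $\sigma = \omega_1 \to \omega_2 \to \cdots \to \omega_s = \pi$ ($s \ge 1$), where each $\omega_t$ ($2\le t\le s$) is a simple reduction of $\omega_{t-1}$ (in particular $\pi\preceq\pi$). *)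

(* Defs.v *)
From HB Require Import structures.
From mathcomp Require Import all_boot all_order all_algebra all_fingroup.
From mathcomp Require Import all_classical all_reals all_analysis.

Set Implicit Arguments.
Unset Strict Implicit.
Unset Printing Implicit Defensive.

Import Order.TTheory GRing.Theory Num.Theory.
Import numFieldNormedType.Exports.

Local Open Scope ring_scope.

(* Permutations of [n] are elements of 'S_n, acting on {0, ..., n-1}; the entry
   of [s] in position [i] of the one-line notation is [s i].  In MathComp,
   (tperm i j * s) k = s (tperm i j k), so multiplying by [tperm i j] on the
   left exchanges the entries in positions [i] and [j] (not the values). *)
Definition simple_reduction (n : nat) : rel 'S_n := fun s t =>
  [exists i : 'I_n, exists j : 'I_n,
    [&& j == i.+1 :> nat, (s j < s i)%N & t == (tperm i j * s)%g]].

(* [connect] is the reflexive-transitive closure: the chain of simple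
   reductions starts at the larger permutation [s] and ends at [p]. *)
Definition weak_le (n : nat) (p s : 'S_n) : bool :=
  connect (@simple_reduction n) s p.

Definition unif_prob (R : realType) (T : finType) (A : {set T}) : R :=
  #|A|%:R / #|T|%:R.

(* Two independent uniform permutations form a uniform element of 'S_n * 'S_n. *)
Definition Pstar (R : realType) (n : nat) : R :=
  unif_prob R [set ps : 'S_n * 'S_n | weak_le ps.1 ps.2].

Definition harmonic_number (R : realType) (i : nat) : R :=
  \sum_(1 <= j < i.+1) j%:R^-1.

(* Main.v *)
Require Import Defs.
From HB Require Import structures.
From mathcomp Require Import all_boot all_order all_algebra all_fingroup.
From mathcomp Require Import all_classical all_reals all_analysis.
From mathcomp Require Import zify ring lra.
From mathcomp Require Import fintype finset.

Set Implicit Arguments.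
Unset Strict Implicit.
Unset Printing Implicit Defensive.

Import Order.TTheory GRing.Theory Num.Theory.
Import numFieldNormedType.Exports.

(** The weak order is containment of inversion sets. Read for the inverse
    permutations [q = p^-1] and [v = s^-1], [p] lies below [s] exactly when [q]
    is a linear extension of the two-dimensional order [dominance v], in which
    [a] is below [b] when both [a < b] and [v a < v b]. So the number of
    comparable pairs is the sum over [v] of the number [e v] of linear
    extensions of [dominance v].

    - Submultiplicativity: cut the positions [0, ..., m + n - 1] into the first
      [m] and the last [n]. A permutation is determined by its two patterns and
      by the set of values that it takes on the first block, and restricting a
      comparable pair to a block gives a comparable pair. So the number of
      comparable pairs is at most ['C(m + n, m) ^ 2] times the product of the
      numbers for the blocks, which is the claim after normalization
      ([card_comparable_pairs_add]).
    - Lower bound: any finite order on [n] elements has at least [n!] divided by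
      the product of the sizes of its principal down-sets as linear extensions
      ([fact_le_linear_extensions]). For [dominance v] the size of the down-set
      of [a] is the relative rank of [v a] among the values of [v] up to [a];
      for a uniform [v] these ranks are independent and uniform on
      [{1, ..., a + 1}], so that their inverses have expectations
      [H(a + 1) / (a + 1)] ([sum_prod_inv_down_set]).
    - Upper bound: an order all of whose antichains have at most [w] elements
      has at most [w ^ n] linear extensions, and an antichain of [dominance v]
      is a decreasing subsequence of [v]. At most a proportion of
      ['C(n, k) / k!] of all [v] has a decreasing subsequence of length [k].
      Taking for [w] the quotient of [n] by a constant [m], and [k = w + 1],
      bounds the probability by [w ^ n / n! + 'C(n, k) / k!]. The first term is
      at most [(exp 1 / m) ^ n], and the second decays faster than any geometric
      sequence because [k] grows linearly with [n]. Hence the probability is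
      [O((4 / m) ^ n)] for every [m] ([Pstar_le_geometric]).

    With [m = 12] the last bound is better than the required one, and with [m]
    growing it shows that the [n]-th roots tend to [0], which is the value of
    [rho]. *)

Local Open Scope nat_scope.

(** * Monotone permutations and patterns *)

Lemma ltn_ord_neq n (x y : 'I_n) : x != y -> x <= y -> x < y.
Proof. by move=> neq_xy le_xy; rewrite ltn_neqAle le_xy andbT. Qed.

Lemma leq_card_bigcup (I T : finType) (P : pred I) (F : I -> {set T}) :
  #|\bigcup_(i | P i) F i| <= \sum_(i | P i) #|F i|.
Proof.
elim/big_rec2: _ => [|i k A _ IH]; first by rewrite cards0.
by apply: leq_trans (leq_card_setU _ _) _; rewrite leq_add2l.
Qed.

Definition rank_in n (A : {set 'I_n}) (x : 'I_n) := #|[set y in A | y < x]|.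

Lemma rank_in_lt n (A : {set 'I_n}) (x y : 'I_n) :
  x \in A -> x < y -> rank_in A x < rank_in A y.
Proof.
move=> Ax lt_xy; apply/proper_card/properP; split.
  by apply/subsetP=> z; rewrite !inE => /andP[-> /ltn_trans->].
by exists x; rewrite !inE Ax ?ltnn // lt_xy.
Qed.

Lemma rank_in_inj n (A : {set 'I_n}) : {in A &, injective (rank_in A)}.
Proof.
move=> x y Ax Ay eq_r; case: (ltngtP x y) => [lt_xy|lt_yx|/val_inj//].
  by have := rank_in_lt Ax lt_xy; rewrite eq_r ltnn.
by have := rank_in_lt Ay lt_yx; rewrite eq_r ltnn.
Qed.

Lemma rank_in_imset m n (A : {set 'I_m}) (f : 'I_m -> 'I_n) (x : 'I_m) :
    x \in A -> {in A &, {mono f : x y / x < y}} ->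
  rank_in (f @: A) (f x) = rank_in A x.
Proof.
move=> Ax f_mono; rewrite /rank_in.
have f_inj: {in A &, injective f}.
  move=> a b Aa Ab eq_f; have := f_mono a b Aa Ab; have := f_mono b a Ab Aa.
  by rewrite eq_f !ltnn; case: ltngtP => // /val_inj.
rewrite -(card_in_imset (f := f) (D := [set y in A | y < x])); last first.
  by move=> a b; rewrite !inE => /andP[Aa _] /andP[Ab _]; apply: f_inj.
apply: eq_card => z; apply/idP/imsetP.
  rewrite !inE => /andP[/imsetP[y Ay ->]]; rewrite f_mono // => lt_yx.
  by exists y; rewrite ?inE ?Ay.
by case=> y; rewrite !inE => /andP[Ay lt_yx] ->; rewrite imset_f // f_mono.
Qed.

(** An increasing permutation of [A] preserves ranks in [A], and the rank
    determines the element. *)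
Lemma perm_on_increasing n (A : {set 'I_n}) (s : 'S_n) :
  perm_on A s -> {in A &, {mono s : x y / x < y}} -> s = 1%g.
Proof.
move=> sA s_mono; apply/permP=> x; rewrite perm1.
have [Ax|/(out_perm sA)//] := boolP (x \in A).
apply: (@rank_in_inj _ A); rewrite ?perm_closed //.
rewrite -(rank_in_imset Ax s_mono); congr rank_in.
by rewrite (im_perm_on sA).
Qed.

(** * The weak order as containment of inversions *)

(** Inversions are recorded by their values, since exchanging adjacent entries
    affects a single pair of values. *)
Definition inversions n (s : 'S_n) : {set 'I_n * 'I_n} :=
  [set ab : 'I_n * 'I_n | (ab.1 < ab.2) && (s^-1%g ab.2 < s^-1%g ab.1)].

Lemma tperm_adjacent_lt n (i j x y : 'I_n) :
    j = i.+1 :> nat -> (x, y) != (i, j) -> x < y ->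
  tperm i j x < tperm i j y.
Proof.
move=> ij; rewrite xpair_eqE.
case: (tpermP i j x) => [->|->|/eqP nxi /eqP nxj];
  case: (tpermP i j y) => [->|->|/eqP nyi /eqP nyj];
  rewrite ?eqxx ?ltnn //= ?ij => _.
- by rewrite -ij; apply: ltn_ord_neq; rewrite eq_sym.
- by move=> /ltnW; rewrite ltnn.
- by move/ltnW.
- by move/ltnW.
- by rewrite ltnS; apply: ltn_ord_neq.
Qed.

Lemma simple_reductionP n (s t : 'S_n) :
  reflect (exists i j : 'I_n,
             [/\ j = i.+1 :> nat, s j < s i & t = (tperm i j * s)%g])
          (simple_reduction s t).
Proof.
apply: (iffP existsP) => [[i /existsP[j /and3P[/eqP ij sji /eqP->]]]|].
  by exists i, j.
case=> i [j [ij sji ->]]; exists i; apply/existsP; exists j.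
by rewrite ij sji !eqxx.
Qed.

Lemma inversions_reduction n (s t : 'S_n) :
  simple_reduction s t -> inversions t \proper inversions s.
Proof.
case/simple_reductionP=> i [j [ij sji ->]].
apply/properP; split.
  apply/subsetP=> -[a b]; rewrite !inE /= invMg tpermV !permM => /andP[ab lt_t].
  rewrite ab; set x := _ b in lt_t *; set y := _ a in lt_t *.
  have neq_xy : (tperm i j x, tperm i j y) != (i, j).
    apply: contraTneq ab => -[/(congr1 (tperm i j)) ex /(congr1 (tperm i j)) ey].
    rewrite tpermK tpermL in ex; rewrite tpermK tpermR in ey.
    by rewrite -(permKV s a) -(permKV s b) -/x -/y ex ey -leqNgt ltnW.
  by have := tperm_adjacent_lt ij neq_xy lt_t; rewrite !tpermK.
exists (s j, s i); rewrite !inE /= sji ?permK /= ?ij ?ltnSn //.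
by rewrite invMg tpermV !permM !permK tpermL tpermR ij ltnNge leqnSn.
Qed.

Lemma adjacent_descent n (s : 'S_n) :
  s != 1%g -> exists i j : 'I_n, j = i.+1 :> nat /\ s j < s i.
Proof.
move=> s_neq1; case: (pickP [pred ij : 'I_n * 'I_n |
    (ij.2 == ij.1.+1 :> nat) && (s ij.2 < s ij.1)]) => [[i j]|no_desc].
  by case/andP=> /eqP ij sji; exists i, j.
case/eqP: s_neq1; apply: (@perm_on_increasing _ setT); first by apply/subsetP.
have s_adj (i j : 'I_n) : j = i.+1 :> nat -> s i < s j.
  move=> ij; have := no_desc (i, j); rewrite /= ij eqxx /= => /negbT.
  rewrite -leqNgt; apply: ltn_ord_neq; rewrite (inj_eq perm_inj).
  by apply/eqP=> eq_ij; move: ij; rewrite eq_ij; lia.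
have s_homo k (i j : 'I_n) : j = i + k.+1 :> nat -> s i < s j.
  elim: k => [|k IHk] in j *; rewrite ?addn1 ?addnS => ij; first exact: s_adj.
  have [l il] : exists l : 'I_n, l = i + k.+1 :> nat.
    have ltkn : i + k.+1 < n by rewrite (leq_trans _ (ltn_ord j)) // ij addnS.
    by exists (Ordinal ltkn).
  by apply: ltn_trans (IHk l il) (s_adj l j _); rewrite ij il addnS.
have s_homo' (i j : 'I_n) : i < j -> s i < s j.
  by move=> lt_ij; apply: (s_homo (j - i).-1); lia.
move=> i j _ _; case: (ltngtP i j) => [/s_homo'//|/s_homo'|/val_inj->].
  by rewrite ltnNge => /negbTE; rewrite leq_eqVlt orbC => /norP[/negbTE].
by rewrite ltnn.
Qed.

(** Reductions only remove inversions. Conversely, if the inversions of [p] lie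
    among those of [s] and [p != s], then [s] has a descent at two adjacent
    positions whose entries [p] does not invert; exchanging them removes exactly
    that inversion, so that the containment persists, and the number of
    inversions of [s] decreases. *)
Lemma weak_leE n (p s : 'S_n) :
  weak_le p s = (inversions p \subset inversions s).
Proof.
apply/idP/idP.
  case/connectP=> c; elim: c s => [|t c IHc] s /=; first by move=> _ ->.
  case/andP=> /inversions_reduction/proper_sub sub_ts c_path /IHc sub.
  exact: subset_trans (sub c_path) sub_ts.
have [m] := ubnP #|inversions s|; elim: m s => // m IHm s le_m sub_ps.
have [->|neq_ps] := eqVneq p s; first exact: connect0.
have : (s * p^-1)%g != 1%g by rewrite -eq_mulgV1 eq_sym.
(* A descent of [s * p^-1] is a pair of adjacent entries of [s] which [p] has in
   the opposite order, and by containment it must be a descent of [s]. *)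
case/adjacent_descent=> i [j [ij]]; rewrite !permM => lt_p.
have pnotin : (s j, s i) \notin inversions p.
  by rewrite inE /= negb_and -!leqNgt (ltnW lt_p) orbT.
have sji : s j < s i.
  rewrite ltnNge; apply/negP=> le_ij.
  have lt_ij : s i < s j.
    apply: ltn_ord_neq le_ij; rewrite (inj_eq perm_inj).
    by apply/eqP=> /(congr1 val) /=; lia.
  have /(subsetP sub_ps) : (s i, s j) \in inversions p by rewrite inE /= lt_ij.
  by rewrite inE /= !permK lt_ij /= ij; lia.
have red : simple_reduction s (tperm i j * s)%g.
  by apply/simple_reductionP; exists i, j.
apply: connect_trans (connect1 red) _; apply: IHm.
  exact: leq_trans (proper_card (inversions_reduction red)) _.
apply/subsetP=> -[a b] abp; have := subsetP sub_ps _ abp.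
rewrite !inE /= invMg tpermV !permM => /andP[-> lt_s] /=.
apply: tperm_adjacent_lt => //; apply: contraNneq pnotin => -[<- <-].
by rewrite !permKV.
Qed.

(** * Counting linear extensions *)

Definition linear_extensions n (Q : rel 'I_n) : {set 'S_n} :=
  [set q : 'S_n | [forall a, forall b, Q a b ==> (q a < q b)]].

Lemma linear_extensionsP n (Q : rel 'I_n) (q : 'S_n) :
  reflect (forall a b, Q a b -> q a < q b) (q \in linear_extensions Q).
Proof.
rewrite inE; apply: (iffP forallP) => [ext a b|ext a].
  exact/implyP/(forallP (ext a)).
by apply/forallP=> b; apply/implyP/ext.
Qed.

Definition dominance n (v : 'S_n) : rel 'I_n :=
  fun a b => (a < b) && (v a < v b).

Lemma weak_le_linear_extensions n (p s : 'S_n) :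
  weak_le p s = (p^-1%g \in linear_extensions (dominance s^-1%g)).
Proof.
rewrite weak_leE; apply/subsetP/linear_extensionsP => [sub a b|ext [a b]].
  case/andP=> lt_ab lt_s; rewrite ltnNge leq_eqVlt; apply/norP; split.
    rewrite (inj_eq val_inj) (inj_eq perm_inj).
    by apply: contraTneq lt_ab => ->; rewrite ltnn.
  apply: contraTN lt_s => lt_p; rewrite -leqNgt.
  by have := sub (a, b); rewrite !inE /= lt_ab lt_p => /(_ isT)/ltnW.
rewrite !inE /= => /andP[lt_ab lt_p]; rewrite lt_ab ltnNge leq_eqVlt.
apply/norP; split.
  rewrite (inj_eq val_inj) (inj_eq perm_inj).
  by apply: contraTneq lt_ab => ->; rewrite ltnn.
by apply: contraTN lt_p => lt_s; rewrite -leqNgt ltnW // ext // /dominance lt_ab.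
Qed.

Definition comparable_pairs n : {set 'S_n * 'S_n} :=
  [set vq | vq.2 \in linear_extensions (dominance vq.1)].

(** Inversion of permutations turns the weak order into a counting problem for
    linear extensions of two-dimensional orders. *)
Lemma card_weak_le n :
  #|[set ps : 'S_n * 'S_n | weak_le ps.1 ps.2]| = #|comparable_pairs n|.
Proof.
pose h (vq : 'S_n * 'S_n) := (vq.2^-1%g, vq.1^-1%g).
have hK : involutive h by case=> p s; rewrite /h /= !invgK.
rewrite -!sum1dep_card [LHS](reindex_inj (inv_inj hK)) /=.
by apply: eq_bigl => vq; rewrite weak_le_linear_extensions !invgK.
Qed.

Lemma card_comparable_pairs n :
  #|comparable_pairs n| = \sum_(v : 'S_n) #|linear_extensions (dominance v)|.
Proof.
rewrite -sum1dep_card.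
rewrite -(pair_big_dep xpredT (fun v q => q \in linear_extensions (dominance v))
  (fun _ _ => 1)) /=.
by apply: eq_bigr => v _; rewrite sum1_card.
Qed.

(** Removing one entry from a permutation in ['S_n.+1], either that of a given
    value ([lift_perm_dom_inj]) or that in a given position
    ([lift_perm_cod_inj]), leaves a permutation in ['S_n] and the removed
    position or value; both correspondences are bijective by counting. *)
Lemma lift_perm_dom_inj n (j : 'I_n.+1) :
  injective (fun xq : 'I_n.+1 * 'S_n => lift_perm xq.1 j xq.2).
Proof.
move=> [x q] [y r] /= /permP eq_qr.
have exy : x = y.
  have := eq_qr x; rewrite lift_perm_id; case: (unliftP y x) => [k|] -> //.
  by rewrite lift_perm_lift => /eqP; rewrite (negbTE (neq_lift _ _)).
rewrite exy in eq_qr *; congr (_, _); apply/permP=> k.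
by have := eq_qr (lift y k); rewrite !lift_perm_lift => /lift_inj.
Qed.

Lemma lift_perm_cod_inj n (i : 'I_n.+1) :
  injective (fun xq : 'I_n.+1 * 'S_n => lift_perm i xq.1 xq.2).
Proof.
move=> [x q] [y r] /= /(congr1 invg); rewrite !lift_permV.
by move/(@lift_perm_dom_inj _ i (_, _) (_, _)) => [-> /invg_inj->].
Qed.

Lemma card_ord_Sn n : #|{: 'I_n.+1 * 'S_n}| = #|'S_n.+1|.
Proof. by rewrite card_prod card_ord !card_Sn. Qed.

Lemma big_lift_perm_dom (T : Type) (idx : T) (op : Monoid.com_law idx) n
    (j : 'I_n.+1) (F : 'S_n.+1 -> T) :
  \big[op/idx]_q F q =
  \big[op/idx]_x \big[op/idx]_(q : 'S_n) F (lift_perm x j q).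
Proof.
rewrite pair_bigA; apply: reindex; apply: onW_bij.
by apply: inj_card_bij (@lift_perm_dom_inj n j) _; rewrite card_ord_Sn.
Qed.

Lemma big_lift_perm_cod (T : Type) (idx : T) (op : Monoid.com_law idx) n
    (i : 'I_n.+1) (F : 'S_n.+1 -> T) :
  \big[op/idx]_q F q =
  \big[op/idx]_x \big[op/idx]_(q : 'S_n) F (lift_perm i x q).
Proof.
rewrite pair_bigA; apply: reindex; apply: onW_bij.
by apply: inj_card_bij (@lift_perm_cod_inj n i) _; rewrite card_ord_Sn.
Qed.

Lemma ltn_lift n (h : 'I_n.+1) (i j : 'I_n) : (lift h i < lift h j) = (i < j).
Proof. by rewrite !ltnNge; congr (~~ _); rewrite /= leq_bump2. Qed.

Definition maximal n (Q : rel 'I_n) : pred 'I_n :=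
  fun x => [forall b, ~~ Q x b].

Definition remove n (x : 'I_n.+1) (Q : rel 'I_n.+1) : rel 'I_n :=
  relpre (lift x) Q.

(** Here [x] is the element that the linear extension [lift_perm x ord_max q]
    puts last. *)
Lemma lift_perm_linear_extension n (Q : rel 'I_n.+1) x (q : 'S_n) :
  (lift_perm x ord_max q \in linear_extensions Q) =
  maximal Q x && (q \in linear_extensions (remove x Q)).
Proof.
apply/linear_extensionsP/andP => [ext|[/forallP x_max q_ext] a b].
  split.
    apply/forallP=> b; apply/negP=> /ext; rewrite lift_perm_id.
    by rewrite ltnNge leq_ord.
  apply/linear_extensionsP=> a b /ext.
  by rewrite !lift_perm_lift ltn_lift.
have ext := linear_extensionsP _ _ q_ext.
case: (unliftP x a) => [a'|] ->; last by rewrite (negbTE (x_max b)).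
case: (unliftP x b) => [b'|] -> Qab.
  by rewrite !lift_perm_lift ltn_lift; apply: ext.
by rewrite lift_perm_lift lift_perm_id lift_max /=.
Qed.

(** Sort the linear extensions by their last element. *)
Lemma card_linear_extensions_rec n (Q : rel 'I_n.+1) :
  #|linear_extensions Q| =
  \sum_(x | maximal Q x) #|linear_extensions (remove x Q)|.
Proof.
rewrite -sum1_card big_mkcond (big_lift_perm_dom _ ord_max) [RHS]big_mkcond /=.
apply: eq_bigr => x _; under eq_bigr => q _ do rewrite lift_perm_linear_extension.
case: ifP => _ /=; last by rewrite big1.
by rewrite -big_mkcond sum1_card.
Qed.

Lemma card_linear_extensions0 (Q : rel 'I_0) : #|linear_extensions Q| = 1.
Proof.
rewrite (_ : linear_extensions Q = [set: 'S_0]); first by rewrite cardsT card_Sn.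
by apply/setP=> q; rewrite in_setT; apply/linear_extensionsP=> -[].
Qed.

Definition antichain n (Q : rel 'I_n) (A : {set 'I_n}) :=
  [forall a in A, forall b in A, ~~ Q a b].

Lemma antichainP n (Q : rel 'I_n) (A : {set 'I_n}) :
  reflect {in A &, forall a b, ~~ Q a b} (antichain Q A).
Proof.
apply: (iffP forall_inP) => [anti a b Aa Ab|anti a Aa].
  exact: (forall_inP (anti a Aa)).
by apply/forall_inP=> b; apply: anti.
Qed.

(** Maximal elements are pairwise incomparable, so each step of the recursion
    offers at most [w] choices. *)
Lemma card_linear_extensions_width n w (Q : rel 'I_n) :
    (forall A : {set 'I_n}, antichain Q A -> #|A| <= w) ->
  #|linear_extensions Q| <= w ^ n.
Proof.
elim: n => [|n IHn] in Q *; first by rewrite card_linear_extensions0.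
move=> width_Q; rewrite card_linear_extensions_rec expnS.
have max_w : #|[set x | maximal Q x]| <= w.
  apply/width_Q/antichainP=> a b; rewrite inE => /forallP a_max _; exact: a_max.
apply: leq_trans (leq_mul max_w (leqnn _)); rewrite cardsE -sum_nat_const.
apply: leq_sum => x _; apply: IHn => A /antichainP antiA.
rewrite -(card_imset _ (@lift_inj _ x)); apply/width_Q/antichainP.
by move=> _ _ /imsetP[a Aa ->] /imsetP[b Ab ->]; apply: antiA.
Qed.

Lemma card_linear_extensions_fact n (Q : rel 'I_n) :
  #|linear_extensions Q| <= n`!.
Proof. by rewrite -(card_Sn n) max_card. Qed.

Definition down_set n (Q : rel 'I_n) (x : 'I_n) : {set 'I_n} :=
  [set y | (y == x) || Q y x].

(** Every element lies below a maximal one. *)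
Lemma down_set_maximal_cover n (Q : rel 'I_n) :
    irreflexive Q -> transitive Q ->
  n <= \sum_(x | maximal Q x) #|down_set Q x|.
Proof.
move=> Qirr Qtr.
have above y : exists2 x, maximal Q x & y \in down_set Q x.
  have y_in : y \in [pred x | y \in down_set Q x] by rewrite !inE eqxx.
  (* Passing to a larger element enlarges the down-set, so one at or above [y]
     with the largest down-set is maximal. *)
  case: (arg_maxnP (fun x => #|down_set Q x|) y_in) => x /= yx x_max.
  exists x => //; apply/forallP=> z; apply/negP=> Qxz.
  have sub : down_set Q x \proper down_set Q z.
    apply/properP; split.
      apply/subsetP=> u; rewrite !inE => /predU1P[->|Qux]; first by rewrite Qxz orbT.
      by rewrite (Qtr x) ?orbT.
    exists z; rewrite !inE ?eqxx //; apply/norP; split.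
      by apply: contraTneq Qxz => ->; rewrite Qirr.
    by apply/negP=> /(Qtr _ _ _ Qxz); rewrite Qirr.
  have := x_max z; rewrite leqNgt proper_card //= => /(_ _)/negP[] //.
  exact: subsetP (proper_sub sub) _ yx.
have cover_max : [set: 'I_n] \subset \bigcup_(x | maximal Q x) down_set Q x.
  by apply/subsetP=> y _; have [x xm yx] := above y; apply/bigcupP; exists x.
have := subset_leq_card cover_max; rewrite cardsT card_ord => /leq_trans; apply.
exact: leq_card_bigcup.
Qed.

Lemma card_down_set_remove n (Q : rel 'I_n.+1) x y :
  maximal Q x -> #|down_set (remove x Q) y| = #|down_set Q (lift x y)|.
Proof.
move/forallP=> x_max; rewrite -(card_imset _ (@lift_inj _ x)).
apply: eq_card => z; rewrite inE; apply/imsetP/idP => [[u]|].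
  by rewrite inE => u_in ->; rewrite (inj_eq lift_inj).
case: (unliftP x z) => [u|] ->; last first.
  by rewrite (negbTE (x_max _)) (negbTE (neq_lift _ _)).
by rewrite (inj_eq lift_inj) => u_in; exists u; rewrite ?inE.
Qed.

(** An analogue of the hook length formula for forests. Removing a maximal [x]
    does not change the other down-sets, so by induction the extensions ending
    in [x] number at least [#|down_set Q x| / n] times the bound, and these
    fractions sum to at least 1. *)
Lemma fact_le_linear_extensions n (Q : rel 'I_n) :
    irreflexive Q -> transitive Q ->
  n`! <= #|linear_extensions Q| * \prod_x #|down_set Q x|.
Proof.
elim: n => [|n IHn] in Q *; first by rewrite big_ord0 card_linear_extensions0.
move=> Qirr Qtr; rewrite factS card_linear_extensions_rec big_distrl /=.
apply: leq_trans (leq_mul (down_set_maximal_cover Qirr Qtr) (leqnn _)) _.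
rewrite big_distrl /=; apply: leq_sum => x x_max.
rewrite (bigD1_ord x) //= mulnCA leq_mul2l; apply/orP; right.
under eq_bigr => y _ do rewrite -card_down_set_remove //.
by apply: IHn => [a|b a c]; [apply: Qirr | apply: Qtr].
Qed.

(** * Patterns and submultiplicativity *)

Lemma pattern_subproof m n (f : 'I_m -> 'I_n) (a : 'I_m) :
  #|[set b | f b < f a]| < m.
Proof.
rewrite -[X in _ < X]card_ord -cardsT; apply/proper_card/properP.
by split; [apply: subsetT | exists a; rewrite !inE ?ltnn].
Qed.

(** The standardization of a sequence of distinct values. *)
Definition pattern_fun m n (f : 'I_m -> 'I_n) (a : 'I_m) : 'I_m :=
  Ordinal (pattern_subproof f a).

Lemma pattern_fun_lt m n (f : 'I_m -> 'I_n) a b :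
  (pattern_fun f a < pattern_fun f b) = (f a < f b).
Proof.
have le_pattern c d : f c <= f d -> pattern_fun f c <= pattern_fun f d.
  move=> le_cd; apply/subset_leq_card/subsetP=> e; rewrite !inE => lt_ec.
  exact: leq_trans lt_ec le_cd.
apply/idP/idP=> [|lt_ab]; first rewrite !ltnNge.
  by apply: contra; apply: le_pattern.
apply/proper_card/properP; split.
  by apply/subsetP=> e; rewrite !inE => /ltn_trans->.
by exists a; rewrite !inE ?ltnn.
Qed.

Lemma pattern_fun_inj m n (f : 'I_m -> 'I_n) :
  injective f -> injective (pattern_fun f).
Proof.
move=> f_inj a b eq_ab; have := pattern_fun_lt f a b; have := pattern_fun_lt f b a.
by rewrite eq_ab ltnn; case: ltngtP => // /val_inj/f_inj.
Qed.

(** A value is determined by the set of all values and by its rank there. *)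
Lemma eq_image_pattern m n (f g : 'I_m -> 'I_n) :
    injective f -> injective g ->
    f @: setT = g @: setT -> pattern_fun f =1 pattern_fun g ->
  f =1 g.
Proof.
have rank_pattern (h : 'I_m -> 'I_n) a :
    injective h -> rank_in (h @: setT) (h a) = pattern_fun h a.
  move=> h_inj; rewrite /= -(card_imset _ h_inj); apply: eq_card => y.
  apply/setIdP/imsetP => [[/imsetP[b _ ->] lt_ba]|[b]].
    by exists b; rewrite ?inE.
  by rewrite inE => lt_ba ->; rewrite imset_f.
move=> f_inj g_inj eq_im eq_pat a.
apply: (@rank_in_inj _ (f @: setT)); rewrite ?imset_f // ?eq_im ?imset_f //.
by rewrite -{1}eq_im !rank_pattern // eq_pat.
Qed.

Definition pattern m n (l : 'I_m -> 'I_n) (l_inj : injective l) (v : 'S_n) :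
    'S_m :=
  perm (pattern_fun_inj (inj_comp (@perm_inj _ v) l_inj)).

Lemma pattern_lt m n (l : 'I_m -> 'I_n) (l_inj : injective l) (v : 'S_n) a b :
  (pattern l_inj v a < pattern l_inj v b) = (v (l a) < v (l b)).
Proof. by rewrite !permE pattern_fun_lt. Qed.

Lemma pattern_comparable m n (l : 'I_m -> 'I_n) (l_inj : injective l)
    (v q : 'S_n) :
    {mono l : a b / a < b} -> (v, q) \in comparable_pairs n ->
  (pattern l_inj v, pattern l_inj q) \in comparable_pairs m.
Proof.
rewrite [_ \in comparable_pairs n]inE [_ \in comparable_pairs m]inE /=.
move=> l_mono /linear_extensionsP ext; apply/linear_extensionsP=> a b.
case/andP=> lt_ab; rewrite !pattern_lt => lt_v.
by rewrite ext // /dominance l_mono lt_ab.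
Qed.

Definition cut m n (v : 'S_(m + n)) :=
  (v @: (@lshift m n @: setT), pattern (@lshift_inj m n) v,
   pattern (@rshift_inj m n) v).

Lemma cut_inj m n : injective (@cut m n).
Proof.
move=> u v [eq_im eq_l eq_r].
have eq_imr : u @: (@rshift m n @: setT) = v @: (@rshift m n @: setT).
  have rC (w : 'S_(m + n)) :
      w @: (@rshift m n @: setT) = ~: (w @: (@lshift m n @: setT)).
    apply/setP=> y; rewrite -[y](permKV w) (mem_imset _ _ perm_inj) inE.
    rewrite (mem_imset _ _ perm_inj); case: (split_ordP (w^-1%g y)) => i ->.
      rewrite imset_f //=; apply/imsetP=> -[j _ /eqP].
      by rewrite eq_lrshift.
    rewrite imset_f //; apply/esym/imsetP=> -[j _ /eqP].
    by rewrite eq_rlshift.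
  by rewrite !rC eq_im.
apply/permP=> x; case: (split_ordP x) => i ->.
  apply: (eq_image_pattern (f := u \o @lshift m n) (g := v \o @lshift m n)) i.
  - exact: inj_comp perm_inj (@lshift_inj m n).
  - exact: inj_comp perm_inj (@lshift_inj m n).
  - by rewrite [LHS]imset_comp [RHS]imset_comp.
  by move=> i; have /permP/(_ i) := eq_l; rewrite !permE.
apply: (eq_image_pattern (f := u \o @rshift m n) (g := v \o @rshift m n)) i.
- exact: inj_comp perm_inj (@rshift_inj m n).
- exact: inj_comp perm_inj (@rshift_inj m n).
- by rewrite [LHS]imset_comp [RHS]imset_comp.
by move=> i; have /permP/(_ i) := eq_r; rewrite !permE.
Qed.

Lemma card_cut_image m n (v : 'S_(m + n)) : #|(cut v).1.1| = m.
Proof.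
by rewrite /= !card_imset ?cardsT ?card_ord //; [apply: lshift_inj | apply: perm_inj].
Qed.

(** Cutting both members of a comparable pair gives two sets of values and a
    comparable pair for each block. *)
Lemma card_comparable_pairs_add m n :
  #|comparable_pairs (m + n)| <=
  'C(m + n, m) ^ 2 * (#|comparable_pairs m| * #|comparable_pairs n|).
Proof.
pose draws := [set A : {set 'I_(m + n)} | #|A| == m].
have card_draws : #|draws| = 'C(m + n, m).
  by rewrite /draws card_draws card_ord.
pose cuts (vq : 'S_(m + n) * 'S_(m + n)) :=
  let: (V, v1, v2) := cut vq.1 in let: (Q, q1, q2) := cut vq.2 in
  ((V, Q), ((v1, q1), (v2, q2))).
have cuts_inj : injective cuts.
  move=> [u p] [v q] [eqV eqQ equ1 eqp1 equ2 eqp2].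
  by congr (_, _); apply: cut_inj; congr (_, _, _).
rewrite -(card_imset _ cuts_inj) -mulnn -card_draws -!cardsX.
apply/subset_leq_card/subsetP=> _ /imsetP[[v q] vq_in ->].
have im_draws w : (cut w).1.1 \in draws by rewrite inE card_cut_image.
rewrite /cuts !in_setX /= !im_draws !pattern_comparable //.
by move=> a b; rewrite /= ltn_add2l.
Qed.

(** * Long decreasing subsequences are rare *)

Lemma antichain_dominance n (v : 'S_n) (A : {set 'I_n}) :
  antichain (dominance v) A -> {in A &, forall a b, (v b < v a) = (a < b)}.
Proof.
move/antichainP=> anti a b Aa Ab; case: (ltngtP a b) => [lt_ab|lt_ba|/val_inj->].
- have := anti a b Aa Ab; rewrite /dominance lt_ab /= -leqNgt => le_v.
  apply: ltn_ord_neq le_v; rewrite (inj_eq perm_inj).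
  by apply: contraTneq lt_ab => ->; rewrite ltnn.
- by have := anti b a Ab Aa; rewrite /dominance lt_ba /= => /negbTE.
- by rewrite ltnn.
Qed.

(** Rearranging the values of [v] on [A] in all [#|A|`!] ways gives distinct
    permutations, and these are also distinct for different [v] that decrease
    on [A]: the decreasing arrangement of a set of values is unique. *)
Lemma card_antichain_dominance n (A : {set 'I_n}) :
  (#|A|)`! * #|[set v : 'S_n | antichain (dominance v) A]| <= n`!.
Proof.
rewrite -card_perm -[#|perm_on A|]cardsE -cardsX.
rewrite -(card_in_imset (f := fun sv : 'S_n * 'S_n => (sv.1 * sv.2)%g)).
  by rewrite -(card_Sn n) max_card.
move=> [s u] [t v]; rewrite !inE /= => /andP[sA uA] /andP[tA vA] eq_st.
have t_s : (t^-1 * s)%g = 1%g.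
  have rA : perm_on A (t^-1 * s)%g by apply: perm_onM; rewrite ?perm_onV.
  apply: (perm_on_increasing rA) => a b Aa Ab.
  have vE c : v c = u ((t^-1 * s)%g c) by rewrite -permM -mulgA eq_st mulKg.
  rewrite -(antichain_dominance vA Aa Ab) !vE.
  by rewrite (antichain_dominance uA) ?perm_closed.
have est : s = t by apply/eqP; rewrite eq_sym eq_mulVg1 t_s.
by move: eq_st; rewrite est => /mulgI->.
Qed.

(** The permutations with a decreasing subsequence of length [k], written as
    an antichain of the dominance order. *)
Definition wide n k : {set 'S_n} :=
  [set v | [exists A : {set 'I_n}, (#|A| == k) && antichain (dominance v) A]].

(** A union bound over the places of the decreasing subsequence. *)
Lemma card_wide n k : k`! * #|wide n k| <= 'C(n, k) * n`!.
Proof.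
have le_sum : #|wide n k| <=
    \sum_(A : {set 'I_n} | #|A| == k)
      #|[set v : 'S_n | antichain (dominance v) A]|.
  have sub : wide n k \subset \bigcup_(A : {set 'I_n} | #|A| == k)
      [set v : 'S_n | antichain (dominance v) A].
    apply/subsetP=> v; rewrite inE => /existsP[A /andP[Ak vA]].
    by apply/bigcupP; exists A; rewrite ?inE.
  exact: leq_trans (subset_leq_card sub) (leq_card_bigcup _ _).
apply: leq_trans (leq_mul (leqnn _) le_sum) _; rewrite big_distrr /=.
rewrite -[X in 'C(X, _)]card_ord -card_draws -sum_nat_const big_set /=.
apply: leq_sum => A /eqP <-; exact: card_antichain_dominance.
Qed.

(** Either [v] has no decreasing subsequence of length [w.+1], and its dominance
    order has width at most [w], or it is one of the rare exceptions, for which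
    the number of linear extensions is estimated trivially. *)
Lemma card_comparable_pairs_le n w :
  #|comparable_pairs n| <= n`! * w ^ n + #|wide n w.+1| * n`!.
Proof.
rewrite card_comparable_pairs (bigID (mem (wide n w.+1))) /= addnC leq_add //.
  apply: (@leq_trans (\sum_(v : 'S_n | v \notin wide n w.+1) w ^ n)); last first.
    by rewrite sum_nat_const leq_mul // -(card_Sn n) max_card.
  apply: leq_sum => v; rewrite inE => /existsPn narrow.
  apply: card_linear_extensions_width => A antiA; rewrite leqNgt.
  apply/negP=> lt_wA.
  have : 0 < #|[set B : {set 'I_n} | B \subset A & #|B| == w.+1]|.
    by rewrite cards_draws bin_gt0.
  case/card_gt0P=> B; rewrite inE => /andP[/subsetP sBA Bw].
  have := narrow B; rewrite Bw /=; case/negP; apply/antichainP=> a b Ba Bb.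
  by apply: (antichainP _ _ antiA); apply: sBA.
rewrite -sum_nat_const; apply: leq_sum => v _; exact: card_linear_extensions_fact.
Qed.

(** * Relative ranks *)

Lemma dominance_irr n (v : 'S_n) : irreflexive (dominance v).
Proof. by move=> a; rewrite /dominance ltnn. Qed.

Lemma dominance_trans n (v : 'S_n) : transitive (dominance v).
Proof.
move=> b a c /andP[lt_ab lt_vab] /andP[lt_bc lt_vbc]; apply/andP.
by split; [apply: ltn_trans lt_bc | apply: ltn_trans lt_vbc].
Qed.

Lemma card_ord_leq n (j : 'I_n) : #|[set i : 'I_n | i <= j]| = j.+1.
Proof.
rewrite -sum1dep_card -[RHS]card_ord -sum1_card.
by rewrite (big_ord_widen n (fun _ => 1) (ltn_ord j)).
Qed.

(** The next two lemmas compute the relative ranks after inserting a last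
    entry with value [j]: its own rank is determined by [j], and the other ranks
    do not depend on [j]. *)
Lemma card_down_set_max n j (v : 'S_n) :
  #|down_set (dominance (lift_perm ord_max j v)) ord_max| = j.+1.
Proof.
set u := lift_perm _ _ _; rewrite -(card_ord_leq j).
rewrite -(card_imset [set i : 'I_n.+1 | i <= j] (@perm_inj _ u^-1%g)).
apply: eq_card => y.
rewrite -[y in RHS](permK u) (mem_imset _ _ perm_inj) !inE /dominance.
have [->|neq_y] := eqVneq y ord_max; first by rewrite lift_perm_id leqnn.
have u_max : u ord_max = j by apply: lift_perm_id.
rewrite /= u_max (ltn_ord_neq neq_y (leq_ord y)) /= [RHS]leq_eqVlt -[in RHS]u_max.
by rewrite (inj_eq val_inj) (inj_eq perm_inj) (negbTE neq_y) u_max.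
Qed.

Lemma card_down_set_lift n j (v : 'S_n) a :
  #|down_set (dominance (lift_perm ord_max j v)) (lift ord_max a)| =
  #|down_set (dominance v) a|.
Proof.
rewrite -card_down_set_remove; last first.
  by apply/forallP=> b; rewrite /dominance ltnNge leq_ord.
apply: eq_card => b; rewrite !inE /remove /= /dominance.
by rewrite !lift_perm_lift !ltn_lift.
Qed.

Local Open Scope ring_scope.

(** * The probability of comparability *)

Lemma PstarE (R : realType) n :
  Pstar R n = #|comparable_pairs n|%:R / (n`!%:R * n`!%:R).
Proof. by rewrite /Pstar /unif_prob card_weak_le card_prod !card_Sn natrM. Qed.

Lemma Pstar_ge0 (R : realType) n : 0 <= Pstar R n.
Proof. by rewrite PstarE divr_ge0 // mulr_ge0. Qed.

Lemma fact_unit (R : numFieldType) n : n`!%:R != 0 :> R.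
Proof. by rewrite pnatr_eq0 -lt0n fact_gt0. Qed.

Lemma fact_pos (R : numFieldType) n : 0 < n`!%:R :> R.
Proof. by rewrite ltr0n fact_gt0. Qed.

Lemma Pstar_add (R : realType) m n : Pstar R (m + n) <= Pstar R m * Pstar R n.
Proof.
have binE : 'C(m + n, m)%:R = (m + n)`!%:R / (m`!%:R * n`!%:R) :> R.
  by rewrite -(bin_fact (leq_addr n m)) addKn !natrM mulfK ?mulf_neq0 ?fact_unit.
rewrite !PstarE ler_pdivrMr ?mulr_gt0 ?fact_pos //.
apply: le_trans (_ : ('C(m + n, m) ^ 2 *
  (#|comparable_pairs m| * #|comparable_pairs n|))%N%:R <= _).
  by rewrite ler_nat card_comparable_pairs_add.
rewrite natrM natrX natrM binE; have := fact_unit R m; have := fact_unit R n.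
set a := m`!%:R; set b := n`!%:R => b_neq0 a_neq0.
rewrite le_eqVlt; apply/orP; left; apply/eqP; field.
by rewrite a_neq0 b_neq0.
Qed.

(** The relative ranks of a uniform permutation are independent and uniform:
    the sum factors when the last entry is split off. *)
Lemma sum_prod_inv_down_set (R : realType) n :
  \sum_(v : 'S_n) \prod_a (#|down_set (dominance v) a|%:R : R)^-1 =
  \prod_(1 <= i < n.+1) harmonic_number R i.
Proof.
elim: n => [|n IHn].
  rewrite big_geq // (eq_bigr (fun _ => 1)); last by move=> v _; rewrite big_ord0.
  by rewrite sumr_const card_Sn.
rewrite big_nat_recr //= -IHn (big_lift_perm_cod _ ord_max) /=.
have -> : harmonic_number R n.+1 = \sum_(j < n.+1) (j.+1%:R)^-1.
  by rewrite /harmonic_number big_add1 big_mkord.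
rewrite mulrC big_distrl /=; apply: eq_bigr => j _.
rewrite big_distrr /=; apply: eq_bigr => v _.
rewrite (bigD1_ord ord_max) //= card_down_set_max; congr (_ * _).
by apply: eq_bigr => a _; rewrite card_down_set_lift.
Qed.

Lemma Pstar_lower (R : realType) n :
  \prod_(1 <= i < n.+1) (harmonic_number R i / i%:R) <= Pstar R n.
Proof.
rewrite prodf_div -natr_prod -fact_prod -sum_prod_inv_down_set PstarE.
rewrite invfM mulrA ler_pM2r ?invr_gt0 ?fact_pos // ler_pdivlMr ?fact_pos //.
rewrite card_comparable_pairs natr_sum big_distrl /=; apply: ler_sum => v _.
have prod_gt0 : 0 < \prod_a (#|down_set (dominance v) a|%:R : R).
  apply: prodr_gt0 => a _; rewrite ltr0n card_gt0; apply/set0Pn.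
  by exists a; rewrite inE eqxx.
rewrite prodfV mulrC ler_pdivrMr // -natr_prod -natrM ler_nat.
apply: fact_le_linear_extensions; [exact: dominance_irr | exact: dominance_trans].
Qed.

Lemma expr_le_fact_expR (R : realType) (x : R) n :
  0 <= x -> x ^+ n / n`!%:R <= expR x.
Proof.
move=> x_ge0; case: n => [|n].
  by rewrite expr0 fact0 divr1 -[leLHS]expR0 ler_expR.
by apply: le_trans (expR_ge1Dxn n x_ge0); rewrite lerDr.
Qed.

Lemma expR1_le4 (R : realType) : expR 1 <= 4 :> R.
Proof.
have half : 2^-1 <= expR (- 2^-1) :> R.
  by apply: le_trans (expR_ge1Dx _); lra.
have inv_le : (expR (- 2^-1))^-1 <= 2 :> R.
  by rewrite -[leRHS]invrK lef_pV2 // posrE ?expR_gt0 ?invr_gt0.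
have -> : expR 1 = (expR (- 2^-1))^-1 ^+ 2 :> R.
  by rewrite -expRN -expRM_natl; congr expR; field.
have -> : 4 = 2 ^+ 2 :> R by ring.
by rewrite lerXn2r ?nnegrE ?invr_ge0 ?expR_ge0.
Qed.

(** The width bound is used with [w = n %/ m]. Both [n ^ n / n!] and
    [(m ^ m) ^ k / k!] are bounded by the exponential series, at [n] and at
    [m ^ m] respectively; the second estimate turns the rarity of wide
    permutations into a constant factor, because [n < m * k]. *)
Lemma Pstar_le_geometric (R : realType) m : (0 < m)%N ->
  exists2 c : R, 0 < c & forall n, Pstar R n <= c * (4 / m%:R) ^+ n.
Proof.
move=> m_gt0; exists (1 + expR (m ^ m)%:R) => [|n].
  by rewrite addr_gt0 ?expR_gt0.
have mR_gt0 : 0 < m%:R :> R by rewrite ltr0n.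
set w := (n %/ m)%N; set k := w.+1.
have lt_n : (n < m * k)%N by rewrite mulnC -ltn_divLR.
have main : Pstar R n <= (w ^ n)%:R / n`!%:R + 'C(n, k)%:R / k`!%:R.
  have wide_le : #|wide n k|%:R / n`!%:R <= 'C(n, k)%:R / k`!%:R :> R.
    rewrite ler_pdivrMr ?fact_pos // mulrAC ler_pdivlMr ?fact_pos //.
    by rewrite -!natrM ler_nat mulnC card_wide.
  apply: le_trans (lerD (lexx _) wide_le).
  rewrite PstarE ler_pdivrMr ?mulr_gt0 ?fact_pos //.
  apply: le_trans (_ : (n`! * w ^ n + #|wide n k| * n`!)%N%:R <= _).
    by rewrite ler_nat card_comparable_pairs_le.
  rewrite natrD !natrM le_eqVlt; apply/orP; left; apply/eqP; field.
  exact: fact_unit.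
apply: le_trans main _; rewrite mulrDl mul1r; apply: lerD.
  have w_le : w%:R <= n%:R / m%:R :> R.
    by rewrite ler_pdivlMr // -natrM ler_nat leq_divM.
  rewrite natrX exprMn.
  apply: le_trans (_ : (n%:R / m%:R) ^+ n / n`!%:R <= _).
    by rewrite ler_pM2r ?invr_gt0 ?fact_pos // lerXn2r ?nnegrE ?divr_ge0.
  rewrite expr_div_n mulrAC exprVn ler_pM2r ?invr_gt0 ?exprn_gt0 //.
  apply: le_trans (expr_le_fact_expR n (ler0n _ n)) _.
  rewrite -[n%:R]mulr1 expRM_natl lerXn2r ?nnegrE ?expR_ge0 //; exact: expR1_le4.
have bin_le : ('C(n, k) <= 2 ^ n)%N.
  rewrite -[n in 'C(n, k)]card_ord -[n in (2 ^ n)%N]card_ord -!cardsT.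
  rewrite -card_powerset -cards_draws; apply/subset_leq_card/subsetP=> A.
  by rewrite !inE subsetT.
have pow_le : 2 ^+ n <= (m ^ m)%:R ^+ k * (4 / m%:R) ^+ n :> R.
  rewrite expr_div_n mulrA ler_pdivlMr ?exprn_gt0 // mulrC.
  apply: ler_pM; rewrite ?exprn_ge0 //.
    rewrite -!natrX ler_nat -expnM leq_pexp2l // ltnW //.
  by rewrite lerXn2r ?nnegrE // ler_nat.
apply: le_trans (_ : 2 ^+ n / k`!%:R <= _).
  by rewrite ler_pM2r ?invr_gt0 ?fact_pos // -natrX ler_nat.
apply: le_trans (_ : (m ^ m)%:R ^+ k / k`!%:R * (4 / m%:R) ^+ n <= _).
  by rewrite mulrAC ler_pM2r ?invr_gt0 ?fact_pos.
by rewrite ler_wpM2r ?exprn_ge0 ?divr_ge0 // expr_le_fact_expR.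
Qed.

Local Open Scope classical_set_scope.

Lemma root_expr (R : realType) (x : R) n :
  0 <= x -> (0 < n)%N -> (x ^+ n) `^ n%:R^-1 = x.
Proof.
move=> x_ge0 n_gt0; rewrite -powR_mulrn // -powRrM divff ?powRr1 //.
by rewrite pnatr_eq0 -lt0n.
Qed.

Lemma Pstar_root_cvg0 (R : realType) :
  (fun n : nat => Pstar R n `^ (n%:R^-1)) @ \oo --> (0 : R).
Proof.
apply/cvgr0Pnorm_le => e e_gt0.
pose m := (Num.bound (8 / e)).+1.
have m_gt0 : 0 < m%:R :> R by rewrite ltr0n.
have m_large : 8 / m%:R <= e.
  rewrite ler_pdivrMr // mulrC -ler_pdivrMr //.
  apply: le_trans (ltW (archi_boundP _)) _; first by rewrite divr_ge0 // ltW.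
  by rewrite ler_nat.
(* The choice of [m] leaves a factor [2 ^ n] to absorb the constant [c]. *)
have [c c_gt0 Pstar_le] := Pstar_le_geometric R (ltn0Sn _ : 0 < m)%N.
near=> n.
have n_gt0 : (0 < n)%N by near: n; exact: nbhs_infty_gt.
have c_le : c <= 2 ^+ n.
  apply: le_trans (_ : n%:R <= _); first by near: n; exact: nbhs_infty_ger.
  by rewrite -natrX ler_nat ltnW // ltn_expl.
rewrite ger0_norm ?powR_ge0 //; apply: le_trans m_large.
rewrite -[leRHS](@root_expr _ _ n) ?divr_ge0 // ge0_ler_powR ?nnegrE ?invr_ge0 //.
  exact: Pstar_ge0.
apply: le_trans (Pstar_le n) _.
have -> : 8 / m%:R = 2 * (4 / m%:R) :> R by field; rewrite gt_eqF.
by rewrite [leRHS]exprMn ler_wpM2r ?exprn_ge0 ?divr_ge0.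
Unshelve. all: by end_near. Qed.

Theorem theorem2 (R : realType) :
  (forall n1 n2 : nat, (1 <= n1)%N -> (1 <= n2)%N ->
     Pstar R (n1 + n2) <= Pstar R n1 * Pstar R n2) /\
  exists rho : R,
    ((fun n : nat => Pstar R n `^ (n%:R^-1)) @ \oo --> rho) /\
    (exists c : R, 0 < c /\
       forall n : nat, (1 <= n)%N ->
         \prod_(1 <= i < n.+1) (harmonic_number R i / i%:R) <= Pstar R n /\
         Pstar R n <= c * (362%:R / 1000%:R) ^+ n) /\
    rho <= 362%:R / 1000%:R.
Proof.
split=> [n1 n2 _ _|]; first exact: Pstar_add.
exists 0; split; first exact: Pstar_root_cvg0.
split; last by apply: divr_ge0; apply: ler0n.
(* [4 / 12 < 0.362]. *)
have [c c_gt0 Pstar_le] := Pstar_le_geometric R (isT : (0 < 12)%N).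
exists c; split=> // n _; split; first exact: Pstar_lower.
apply: le_trans (Pstar_le n) _.
rewrite ler_pM2l //; apply: lerXn2r.
- by rewrite nnegrE; apply: divr_ge0; apply: ler0n.
- by rewrite nnegrE; apply: divr_ge0; apply: ler0n.
lra.
Qed.
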